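(* Let $p\geq 1$ be an integer and let $(a_n^{(k)})_{n\in\mathbb{Z}}$, $0\leq k\leq p$, be bi-infinite sequences of complex numbers. With the lattice paths, weights and formal power series defined in the context, the following identities hold in $\mathbb{C}((z^{-1}))$: \[ W_{0}(z)=\frac{1}{z-a_{0}^{(0)}-\sum_{j=1}^{p}\sum_{k=0}^{j}a_{-k}^{(j)}\,A_{j-k-1}^{(1)}(z)\,B_{k-1}^{(1)}(z)}, \] where $A_{-1}^{(1)}(z)\equiv B_{-1}^{(1)}(z)\equiv 1$; \[ W_{j}(z)=W_{0}(z)\,A_{j-1}^{(1)}(z)\quad (1\leq j\leq p); \] and more generally \[ W_{j}(z)=W_{i}(z)\,A_{j-i-1}^{(i+1)}(z)\quad (0\leq i<j\leq p). \]
   Context: $\mathbb{C}((z^{-1}))$ denotes the field of formal series $\sum_{n\in\mathbb{Z}} c_n z^{-n}$ with complex coefficients and only finitely many nonzero $c_n$ with $n<0$. Lattice paths have vertices in $\mathbb{Z}_{\geq 0}\times\mathbb{Z}$ and are finite sequences of steps, consecutive steps sharing endpoints; the allowed steps are upsteps $(n,m)\to(n+1,m+1)$, level steps $(n,m)\to(n+1,m)$, and downsteps $(n,m)\to(n+1,m-j)$ with $1\leq j\leq p$. The length of a path is its number of steps (a path of length $0$ is a single vertex). Weights: every upstep has weight $1$; a step $(n,m)\to(n+1,m-j)$ with $0\leq j\leq p$ has weight $a_{m-j}^{(j)}$. The weight $w(\gamma)$ of a path is the product of the weights of its steps ($1$ for a path of length $0$). For an integer $q$, $\gamma+q$ denotes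 the path shifted vertically by $q$ units ($q>0$ upward, $q<0$ downward). $\min(\gamma)$ and $\max(\gamma)$ are the minimal and maximal heights of the vertices of $\gamma$. For $n\geq 0$ and $0\leq j\leq p$: $\mathcal{P}_{[n,j]}$ is the set of all paths of length $n$ from $(0,0)$ to $(n,j)$; $\mathcal{D}_{[n,j]}$ is the set of paths in $\mathcal{P}_{[n,j]}$ with $\min(\gamma)=0$; $\widehat{\mathcal{D}}_{[n,j]}$ is the set of paths of length $n$ from $(0,-j)$ to $(n,0)$ with $\max(\gamma)=0$. Put (empty sums being $0$) $W_{[n,j]}=\sum_{\gamma\in\mathcal{P}_{[n,j]}}w(\gamma)$, and for integers $q\geq0$, $A_{[n,j]}^{(q)}=\sum_{\gamma\in\mathcal{D}_{[n,j]}}w(\gamma+q)$, $B_{[n,j]}^{(q)}=\sum_{\gamma\in\widehat{\mathcal{D}}_{[n,j]}}w(\gamma-q)$. Define formal series $W_j(z)=\sum_{n\ge0}W_{[n,j]}z^{-n-1}$, $A_j^{(q)}(z)=\sum_{n\ge0}A^{(q)}_{[n,j]}z^{-n-1}$, $B_j^{(q)}(z)=\sum_{n\ge0}B^{(q)}_{[n,j]}z^{-n-1}$. *)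

(* Defs.v *)
From HB Require Import structures.
From mathcomp Require Import all_boot all_order all_algebra.
From mathcomp Require Import finmap.
From mathcomp Require Import boolp classical_sets functions cardinality fsbigop.
From mathcomp Require Import reals complex zify.

Set Implicit Arguments.
Unset Strict Implicit.
Unset Printing Implicit Defensive.

Import Order.TTheory GRing.Theory Num.Theory.

Local Open Scope classical_set_scope.
Local Open Scope ring_scope.

(* [lcoef f n] is the coefficient of z^{-n}, so that the terms with n < 0 are  *)
(* the positive powers of z.                                                  *)
Record laurent (K : fieldType) := Laurent {
  lcoef :> int -> K;
  lcoef_finite : finite_set [set n : int | n < 0 /\ lcoef n <> 0]
}.

HB.instance Definition _ (K : fieldType) := gen_eqMixin (laurent K).
HB.instance Definition _ (K : fieldType) := gen_choiceMixin (laurent K).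

Section LaurentField.
Variable K : fieldType.
Implicit Types (f g h : laurent K) (c d : int -> K) (F G H : nat -> K).

Lemma laurentP f g : (forall n, f n = g n) -> f = g.
Proof.
case: f g => [c hc] [d hd] /= /funext e.
by case: _ / e hd => hd; congr Laurent; exact: Prop_irrelevance.
Qed.

Lemma finite_negP c :
  finite_set [set n : int | n < 0 /\ c n <> 0] <->
  exists N : nat, forall n : int, n < - N%:Z -> c n = 0.
Proof.
split=> [/finite_fsetP[A eA]|[N hN]].
  exists (\sum_(i <- A) `|i|)%N => n hn; apply: contrapT => cn0.
  have nA : n \in A.
    have : [set n : int | n < 0 /\ c n <> 0] n by split => //=; lia.
    by rewrite eA.
  have : (`|n| <= \sum_(i <- A) `|i|)%N by rewrite (big_rem _ nA) leq_addr.
  lia.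
apply: (@sub_finite_set _ _ ((fun k : nat => - k%:Z) @` `I_N.+1)); last first.
  exact/finite_image/finite_II.
move=> n [n0 cn0]; exists `|n|%N; last by lia.
rewrite /= ltnS leqNgt; apply/negP => lt; apply: cn0; apply: hN; lia.
Qed.

Lemma lbound f : exists N : nat, forall n : int, n < - N%:Z -> f n = 0.
Proof. by apply/finite_negP; exact: lcoef_finite. Qed.

Lemma ladd_subproof f g :
  finite_set [set n : int | n < 0 /\ f n + g n <> 0].
Proof.
have [N hN] := lbound f; have [M hM] := lbound g.
apply/(finite_negP (fun n => f n + g n)).
by exists (N + M)%N => n hn; rewrite hN ?hM ?addr0//; lia.
Qed.

Lemma lopp_subproof f : finite_set [set n : int | n < 0 /\ - f n <> 0].
Proof.
have [N hN] := lbound f.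
by apply/(finite_negP (fun n => - f n)); exists N => n /hN ->; rewrite oppr0.
Qed.

Lemma lmono_subproof (m : int) (a : K) :
  finite_set [set n : int | n < 0 /\ (if n == m then a else 0) <> 0].
Proof.
apply/(finite_negP (fun n => if n == m then a else 0)).
by exists `|m|%N => n hn; rewrite ifF//; apply/eqP; lia.
Qed.

Definition ladd f g := Laurent (ladd_subproof f g).
Definition lopp f := Laurent (lopp_subproof f).

(* The monomial a z^{-m}. *)
Definition lmono m a := Laurent (lmono_subproof m a).

Lemma laddA : associative ladd.
Proof. by move=> f g h; apply: laurentP => n /=; rewrite addrA. Qed.
Lemma laddC : commutative ladd.
Proof. by move=> f g; apply: laurentP => n /=; rewrite addrC. Qed.
Lemma ladd0 : left_id (lmono 0 0) ladd.
Proof. by move=> f; apply: laurentP => n /=; rewrite if_same add0r. Qed.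
Lemma laddN : left_inverse (lmono 0 0) lopp ladd.
Proof. by move=> f; apply: laurentP => n /=; rewrite if_same addNr. Qed.

HB.instance Definition _ :=
  GRing.isZmodule.Build (laurent K) laddA laddC ladd0 laddN.

(* The Cauchy product; every sum involved is finitely supported (lconvE). *)
Definition lconv c d (n : int) : K := \sum_(i \in [set: int]) c i * d (n - i).

Definition pconv F G (n : nat) : K := \sum_(k < n.+1) F k * G (n - k)%N.

Definition lower c (N : nat) : nat -> K := fun k => c (k%:Z - N%:Z).

Lemma lconv_lt c d (N M : nat) (n : int) :
    (forall n : int, n < - N%:Z -> c n = 0) ->
    (forall n : int, n < - M%:Z -> d n = 0) ->
  n < - (N + M)%:Z -> lconv c d n = 0.
Proof.
move=> hc hd hn; apply: fsbig1 => i _.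
have [lt|le] := ltP i (- N%:Z); first by rewrite hc ?mul0r.
by rewrite hd ?mulr0//; lia.
Qed.

Lemma lconvE c d (N M : nat) (n : nat) :
    (forall n : int, n < - N%:Z -> c n = 0) ->
    (forall n : int, n < - M%:Z -> d n = 0) ->
  lconv c d (n%:Z - (N + M)%:Z) = pconv (lower c N) (lower d M) n.
Proof.
move=> hc hd; pose s := fun k : nat => k%:Z - N%:Z.
rewrite /lconv -(@fsbig_widen _ _ _ _ (s @` `I_n.+1)) //=; last first.
  move=> i [_ /= ni].
  have [lt|le] := ltP i (- N%:Z); first by rewrite hc ?mul0r.
  rewrite hd ?mulr0//; rewrite ltNge; apply/negP => le'; apply: ni.
  by exists (absz (i + N%:Z)); rewrite /s /=; lia.
rewrite fsbig_image => [|x y _ _]; last by rewrite /s; lia.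
rewrite -(@fsbig_ord _ _ _ n.+1 (fun i => c (s i) * d (n%:Z - (N + M)%:Z - s i))).
apply: eq_bigr => k _; congr (_ * d _); rewrite /s.
by have := ltn_ord k; lia.
Qed.

Lemma lmul_subproof f g : finite_set [set n : int | n < 0 /\ lconv f g n <> 0].
Proof.
have [N hN] := lbound f; have [M hM] := lbound g.
apply/finite_negP; exists (N + M)%N => n hn.
exact: (lconv_lt hN hM).
Qed.

Definition lmul f g := Laurent (lmul_subproof f g).

Lemma pconv_poly F G (m n : nat) : (m < n)%N ->
  pconv F G m = ((\poly_(i < n) F i) * (\poly_(i < n) G i))`_m.
Proof.
move=> mn; rewrite coefM; apply: eq_bigr => k _; rewrite !coef_poly.
by rewrite !ifT//; have := ltn_ord k; lia.
Qed.

Lemma eq_pconv F F' G G' n : (forall k, (k <= n)%N -> F k = F' k) ->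
  (forall k, (k <= n)%N -> G k = G' k) -> pconv F G n = pconv F' G' n.
Proof.
move=> eF eG; apply: eq_bigr => k _; rewrite eF ?eG//; first by lia.
by have := ltn_ord k; lia.
Qed.

Lemma pconvC F G n : pconv F G n = pconv G F n.
Proof. by rewrite !(@pconv_poly _ _ n n.+1)// mulrC. Qed.

Lemma pconvA F G H n : pconv F (pconv G H) n = pconv (pconv F G) H n.
Proof.
set P := \poly_(i < n.+1) F i; set Q := \poly_(i < n.+1) G i.
set S := \poly_(i < n.+1) H i.
transitivity ((P * (Q * S))`_n).
  rewrite coefM; apply: eq_bigr => k _; rewrite coef_poly ltn_ord.
  by rewrite (@pconv_poly _ _ _ n.+1)//; have := ltn_ord k; lia.
rewrite mulrA coefM; apply: eq_bigr => k _.
by rewrite (@pconv_poly _ _ _ n.+1)// coef_poly ifT//; have := ltn_ord k; lia.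
Qed.

Lemma lower_lconv f g N M :
    (forall n : int, n < - N%:Z -> f n = 0) ->
    (forall n : int, n < - M%:Z -> g n = 0) ->
  lower (lconv f g) (N + M) = pconv (lower f N) (lower g M).
Proof. by move=> hf hg; apply/funext => n; rewrite -lconvE. Qed.

Lemma lmulC : commutative lmul.
Proof.
move=> f g; apply: laurentP => n /=.
have [N hN] := lbound f; have [M hM] := lbound g.
have [lt|le] := ltP n (- (N + M)%:Z).
  by rewrite (lconv_lt hN hM)// (lconv_lt hM hN)//; lia.
have -> : n = (absz (n + (N + M)%:Z))%:Z - (N + M)%:Z by lia.
by rewrite (lconvE _ hN hM) [in RHS]addnC (lconvE _ hM hN) pconvC addnC.
Qed.

Lemma lmulA : associative lmul.
Proof.
move=> f g h; apply: laurentP => n /=.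
have [N hN] := lbound f; have [M hM] := lbound g; have [L hL] := lbound h.
have hgh (m : int) : m < - (M + L)%:Z -> lconv g h m = 0.
  exact: lconv_lt.
have hfg (m : int) : m < - (N + M)%:Z -> lconv f g m = 0.
  exact: lconv_lt.
have [lt|le] := ltP n (- (N + M + L)%:Z).
  by rewrite (lconv_lt hN hgh) ?(lconv_lt hfg hL)//; lia.
have -> : n = (absz (n + (N + M + L)%:Z))%:Z - (N + M + L)%:Z by lia.
rewrite (lconvE _ hfg hL) -addnA (lconvE _ hN hgh).
by rewrite !lower_lconv// pconvA.
Qed.

Lemma lmono1_lt (n : int) : n < - 0%:Z -> lmono 0 1 n = 0.
Proof. by move=> hn /=; rewrite ifF//; apply/eqP; lia. Qed.

Lemma lmul1 : left_id (lmono 0 1) lmul.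
Proof.
move=> f; apply: laurentP => n; rewrite /lmul [LHS]/=.
rewrite /lconv -(@fsbig_widen _ _ _ _ [set 0]) //=; last first.
  by move=> i [_ /= /eqP/negPf ->]; rewrite mul0r.
by rewrite fsbig_set1 eqxx mul1r subr0.
Qed.

Lemma lmulDl : left_distributive lmul +%R.
Proof.
move=> f g h; apply: laurentP => n /=.
have [N hN] := lbound f; have [M hM] := lbound g; have [L hL] := lbound h.
have hf (m : int) : m < - (N + M)%:Z -> f m = 0 by move=> ?; apply: hN; lia.
have hg (m : int) : m < - (N + M)%:Z -> g m = 0 by move=> ?; apply: hM; lia.
have hfg (m : int) : m < - (N + M)%:Z -> (f + g) m = 0.
  by move=> hm /=; rewrite hf ?hg ?addr0.
have [lt|le] := ltP n (- (N + M + L)%:Z).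
  by rewrite (lconv_lt hfg hL) ?(lconv_lt hf hL) ?(lconv_lt hg hL)// addr0.
have -> : n = (absz (n + (N + M + L)%:Z))%:Z - (N + M + L)%:Z by lia.
rewrite (lconvE _ hfg hL) (lconvE _ hf hL) (lconvE _ hg hL) -big_split /=.
by apply: eq_bigr => k _; rewrite /lower /= mulrDl.
Qed.

Lemma lone_neq0 : lmono 0 1 != 0.
Proof.
by apply/eqP => /(congr1 (fun f => lcoef f 0)) /= /eqP; rewrite oner_eq0.
Qed.

HB.instance Definition _ :=
  GRing.Zmodule_isComNzRing.Build (laurent K)
    lmulA lmulC lmul1 lmulDl lone_neq0.

Fixpoint pinv_seq F (n : nat) : seq K :=
  if n is m.+1 then
    let s := pinv_seq F m in
    rcons s (- (F 0%N)^-1 * \sum_(k < m.+1) s`_k * F (m.+1 - k)%N)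
  else [:: (F 0%N)^-1].

Lemma size_pinv_seq F n : size (pinv_seq F n) = n.+1.
Proof. by elim: n => //= n IH; rewrite size_rcons IH. Qed.

Lemma nth_pinv_seq F n k : (k <= n)%N -> (pinv_seq F n)`_k = (pinv_seq F k)`_k.
Proof.
elim: n => [|n IH]; first by case: k.
rewrite leq_eqVlt => /predU1P[->//|kn].
by rewrite /= nth_rcons size_pinv_seq kn IH.
Qed.

Definition pinv F (n : nat) : K := (pinv_seq F n)`_n.

Lemma pinvP F n : F 0%N != 0 -> pconv (pinv F) F n = (n == 0%N)%:R.
Proof.
move=> F0; case: n => [|n]; first by rewrite /pconv big_ord1 /pinv /= mulVf.
rewrite /pconv big_ord_recr /= subnn /pinv /=.
rewrite nth_rcons size_pinv_seq ltnn eqxx mulrAC mulNr mulVf// mulN1r.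
apply/eqP; rewrite subr_eq0; apply/eqP/eq_bigr => k _.
by rewrite [in RHS]nth_pinv_seq//; have := ltn_ord k; lia.
Qed.

Lemma lvaluation f : f != 0 ->
  exists v : int, f v != 0 /\ forall n : int, n < v -> f n = 0.
Proof.
move=> f0; have [N hN] := lbound f.
have ex : exists k : nat, f (k%:Z - N%:Z) != 0.
  apply: contrapT => /forallNP all0; case/negP: f0; apply/eqP/laurentP => n.
  rewrite /= if_same; have [/hN//|le] := ltP n (- N%:Z).
  have /negP := all0 (absz (n + N%:Z)); rewrite negbK => /eqP <-.
  by congr (f _); lia.
case: (ex_minnP ex) => k fk kmin; exists (k%:Z - N%:Z); split=> // n nlt.
have [/hN//|le] := ltP n (- N%:Z); apply/eqP; apply: contraT => fn.
have := kmin (absz (n + N%:Z)).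
have -> : ((absz (n + N%:Z))%:Z - N%:Z) = n by lia.
by move=> /(_ fn); lia.
Qed.

Lemma lseries_subproof (v : int) F : finite_set
  [set n : int | n < 0 /\ (if n < v then 0 else F (absz (n - v))) <> 0].
Proof.
apply/(finite_negP (fun n => if n < v then 0 else F (absz (n - v)))).
by exists `|v|%N => n hn; rewrite ifT//; lia.
Qed.

(* The series \sum_(k >= 0) F k z^{-(v + k)}. *)
Definition lseries v F := Laurent (lseries_subproof v F).

Lemma lshift_mul (u v : int) F G (n : nat) :
  (lseries u F * lseries v G) (n%:Z + (u + v)) = pconv F G n.
Proof.
pose s := fun k : nat => k%:Z + u.
rewrite [LHS]/= /lconv -(@fsbig_widen _ _ _ _ (s @` `I_n.+1)) //=; last first.
  move=> i [_ /= ni]; case: ltP => le; first by rewrite mul0r.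
  rewrite ifT ?mulr0//; rewrite ltNge; apply/negP => le'; apply: ni.
  by exists (absz (i - u)); rewrite /s /=; lia.
rewrite fsbig_image => [|x y _ _]; last by rewrite /s; lia.
rewrite -(@fsbig_ord _ _ _ n.+1 (fun i => lseries u F (s i)
  * lseries v G (n%:Z + (u + v) - s i))).
apply: eq_bigr => k _ /=; have := ltn_ord k => kn.
rewrite !ifF; [|by apply/negP; rewrite /s; lia..].
by congr (F _ * G _); rewrite /s; lia.
Qed.

Lemma lshift_mul_lt (u v n : int) F G :
  n < u + v -> (lseries u F * lseries v G) n = 0.
Proof.
move=> hn; apply: fsbig1 => i _ /=.
case: ltP => le; first by rewrite mul0r.
by rewrite ifT ?mulr0//; lia.
Qed.

Lemma linv_exists f : f != 0 -> exists g, g * f = 1.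
Proof.
move=> /lvaluation[v [fv hv]]; pose F := fun k : nat => f (k%:Z + v).
have fE : f = lseries v F.
  apply: laurentP => n /=; case: ltP => [/hv//|le].
  by rewrite /F; congr (f _); lia.
exists (lseries (- v) (pinv F)); rewrite [X in _ * X]fE; apply: laurentP => n.
have [lt|le] := ltP n 0.
  by rewrite lshift_mul_lt ?addNr//= ifF//; apply/eqP; lia.
have -> : n = `|n|%N%:Z + (- v + v) by lia.
by rewrite lshift_mul pinvP /F ?add0r// /= addNr addr0; case: `|n|%N.
Qed.

Definition linv f : laurent K :=
  if pselect (exists g, g * f = 1) is left e then projT1 (cid e) else 0.

Lemma lmulVf f : f != 0 -> linv f * f = 1.
Proof.
by move=> /linv_exists ex; rewrite /linv; case: pselect => // e; case: cid.
Qed.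

Lemma linv0 : linv 0 = 0.
Proof.
rewrite /linv; case: pselect => // e; exfalso; case: e => g.
by rewrite mulr0 => /eqP; rewrite eq_sym oner_eq0.
Qed.

HB.instance Definition _ :=
  GRing.ComNzRing_isField.Build (laurent K) lmulVf linv0.

Definition lconst (a : K) : laurent K := lmono 0 a.

Definition lz : laurent K := lmono (-1) 1.

(* The series \sum_(n >= 0) u n z^{-n-1}. *)
Definition lgen (u : nat -> K) : laurent K := lseries 1 u.

End LaurentField.

Section LatticePaths.
Variable p : nat.

(* [None] is the upstep; [Some j] is the level step when j = 0, and the        *)
(* downstep by j units when 1 <= j <= p.                                      *)
Definition step := option 'I_p.+1.

Definition rise (s : step) : int := if s is Some j then - (j : nat)%:Z else 1.

Definition next_vertex (v : nat * int) (s : step) : nat * int :=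
  (v.1.+1, v.2 + rise s).

Record lpath := LPath { start : nat * int; steps : seq step }.

Definition vertices (g : lpath) : seq (nat * int) :=
  start g :: scanl next_vertex (start g) (steps g).

Definition target (g : lpath) : nat * int := last (start g) (vertices g).

Definition path_shift (g : lpath) (q : int) : lpath :=
  LPath ((start g).1, (start g).2 + q) (steps g).

Definition minh (g : lpath) : int :=
  \big[Order.min/(start g).2]_(v <- vertices g) v.2.

Definition maxh (g : lpath) : int :=
  \big[Order.max/(start g).2]_(v <- vertices g) v.2.

Variables (K : fieldType) (a : 'I_p.+1 -> int -> K).

Definition step_weight (v : nat * int) (s : step) : K :=
  if s is Some j then a j (v.2 - (j : nat)%:Z) else 1.

Definition weight (g : lpath) : K :=
  \prod_(vs <- zip (vertices g) (steps g)) step_weight vs.1 vs.2.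

(* The paths of length n with a given starting vertex are enumerated by their *)
(* n-tuples of steps.                                                         *)
Definition Wcoef (j : int) (n : nat) : K :=
  \sum_(s : n.-tuple step | target (LPath (0%N, 0) s) == (n, j))
     weight (LPath (0%N, 0) s).

Definition Acoef (q j : int) (n : nat) : K :=
  \sum_(s : n.-tuple step | (target (LPath (0%N, 0) s) == (n, j))
                            && (minh (LPath (0%N, 0) s) == 0))
     weight (path_shift (LPath (0%N, 0) s) q).

Definition Bcoef (q j : int) (n : nat) : K :=
  \sum_(s : n.-tuple step | (target (LPath (0%N, - j) s) == (n, 0))
                            && (maxh (LPath (0%N, - j) s) == 0))
     weight (path_shift (LPath (0%N, - j) s) (- q)).

Definition Wser (j : int) : laurent K := lgen (Wcoef j).

(* The index j = -1 carries the convention A_{-1} = B_{-1} = 1. *)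
Definition Aser (q j : int) : laurent K :=
  if j == -1 then 1 else lgen (Acoef q j).

Definition Bser (q j : int) : laurent K :=
  if j == -1 then 1 else lgen (Bcoef q j).

End LatticePaths.

(* Main.v *)
Require Import Defs.
From mathcomp Require Import all_boot all_order all_algebra.
From mathcomp Require Import boolp classical_sets fsbigop.
From mathcomp Require Import reals complex zify ring.

Set Implicit Arguments.
Unset Strict Implicit.
Unset Printing Implicit Defensive.

Import Order.TTheory GRing.Theory Num.Theory.
Local Open Scope ring_scope.

(** Let [green S x y] be the generating series of the paths from height x to
    height y whose vertices all have heights in S.  Removing the first step of
    a path gives, for x in S, [z * green S x y = [x = y] + sum over the steps
    at x].  Comparing coefficients shows that such a linear system in x has at
    most one solution without terms of order [< 1] in [1 / z].  Each
    combinatorial decomposition (last visit to height i, first passage to 0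
    from below, first passage to nonpositive heights from above) is then
    proved by checking that both sides solve the same system, which avoids
    bijections between sets of paths.  As paths rise by at most one unit per
    step, the level at which an upward crossing takes place is forced. *)

Section LaurentCoefficients.
Variable K : fieldType.
Implicit Types f g : laurent K.

Lemma lcoef0 n : (0 : laurent K) n = 0.
Proof. by rewrite /= if_same. Qed.

Lemma lcoef_nat (b : bool) n : (b%:R : laurent K) n = (b && (n == 0))%:R.
Proof. by case: b; rewrite ?lcoef0 //=; case: eqP. Qed.

Lemma lcoef_sum I (r : seq I) (P : pred I) (F : I -> laurent K) n :
  (\sum_(i <- r | P i) F i) n = \sum_(i <- r | P i) F i n.
Proof. by apply: (big_morph (fun f => lcoef f n) _ (lcoef0 n)). Qed.

Lemma lcoef_monoM m c f n : (lmono m c * f) n = c * f (n - m).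
Proof.
rewrite [LHS]/= /lconv -(@fsbig_widen _ _ _ _ [set m]%classic) //=; last first.
  by move=> i [_ /= /eqP/negPf ->]; rewrite mul0r.
by rewrite fsbig_set1 eqxx.
Qed.

Definition no_low_terms f := forall n, n < 1 -> f n = 0.

Lemma no_low_terms_lgen u : no_low_terms (@lgen K u).
Proof. by move=> n n1 /=; rewrite n1. Qed.

Lemma lcoef_lgen u (n : nat) : @lgen K u (n%:Z + 1) = u n.
Proof. by rewrite /= ifF; [congr u|]; lia. Qed.

Lemma no_low_termsD f g :
  no_low_terms f -> no_low_terms g -> no_low_terms (f + g).
Proof. by move=> hf hg n n1; rewrite /= hf ?hg ?addr0. Qed.

Lemma no_low_terms_sum I (r : seq I) (P : pred I) (F : I -> laurent K) :
  (forall i, P i -> no_low_terms (F i)) ->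
  no_low_terms (\sum_(i <- r | P i) F i).
Proof. by move=> hF n n1; rewrite lcoef_sum big1 // => i /hF ->. Qed.

Lemma no_low_terms_constM c f : no_low_terms f -> no_low_terms (lconst c * f).
Proof. by move=> hf n n1; rewrite lcoef_monoM subr0 hf ?mulr0. Qed.

Lemma no_low_terms_natM (b : bool) f :
  no_low_terms f -> no_low_terms (b%:R * f).
Proof. by case: b => hf n n1; rewrite ?mul1r ?mul0r ?lcoef0 ?hf. Qed.

Lemma no_low_terms_lgenM u v : no_low_terms (@lgen K u * lgen v).
Proof. by move=> n n1; rewrite lshift_mul_lt //; lia. Qed.

End LaurentCoefficients.

Section Resolvent.
Variables (p : nat) (K : fieldType) (a : 'I_p.+1 -> int -> K).
Implicit Types (S : pred int) (x y : int) (F G : int -> laurent K).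

Definition transfer F x : laurent K :=
  F (x + 1) + \sum_(j < p.+1) lconst (a j (x - j%:Z)) * F (x - j%:Z).

Lemma transferD F G x :
  transfer (fun t => F t + G t) x = transfer F x + transfer G x.
Proof.
rewrite /transfer addrACA; congr (_ + _).
by rewrite -big_split; apply: eq_bigr => j _; rewrite mulrDr.
Qed.

Lemma transferM F f x : transfer (fun t => F t * f) x = transfer F x * f.
Proof.
rewrite /transfer mulrDl mulr_suml; congr (_ + _).
by apply: eq_bigr => j _; rewrite mulrA.
Qed.

Lemma transfer_sum I (r : seq I) (P : pred I) (F : I -> int -> laurent K) x :
  transfer (fun t => \sum_(i <- r | P i) F i t) x =
  \sum_(i <- r | P i) transfer (F i) x.
Proof.
rewrite /transfer big_split; congr (_ + _); rewrite exchange_big.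
by apply: eq_bigr => j _; rewrite mulr_sumr.
Qed.

Lemma lcoef_transfer F x n : transfer F x n =
  F (x + 1) n + \sum_(j < p.+1) a j (x - j%:Z) * F (x - j%:Z) n.
Proof.
rewrite /transfer [LHS]/= lcoef_sum; congr (_ + _).
by apply: eq_bigr => j _; rewrite lcoef_monoM subr0.
Qed.

Lemma transfer_unique S F G :
    (forall x, no_low_terms (F x)) -> (forall x, no_low_terms (G x)) ->
    (forall x, ~~ S x -> F x = G x) ->
    (forall x, S x ->
       lz K * F x - transfer F x = lz K * G x - transfer G x) ->
  forall x, F x = G x.
Proof.
move=> F1 G1 FGN FGS x; apply: laurentP => n.
have [n1|n1] := ltP n 1; first by rewrite F1 ?G1.
have [k ->] : exists k : nat, n = k%:Z by exists (absz n); lia.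
elim: k x => [|k IH] x; first by rewrite F1 ?G1.
have [Sx|/FGN->//] := boolP (S x).
have balance H : (lz K * H x - transfer H x) k%:Z
                 = H x k.+1%:Z - transfer H x k%:Z.
  rewrite -[LHS]/((lz K * H x) _ - _) lcoef_monoM mul1r opprK.
  by congr (H x _ - _); lia.
have /(congr1 (fun f => lcoef f k%:Z)) := FGS _ Sx; rewrite !balance.
rewrite !lcoef_transfer IH; under eq_bigr do rewrite IH.
exact: addIr.
Qed.

(* The total weight of the paths of length n from height x to height y with  *)
(* all vertex heights in S.                                                  *)
Fixpoint wsum S x y (n : nat) : K :=
  if S x then
    if n is m.+1 then
      wsum S (x + 1) y m
      + \sum_(j < p.+1) a j (x - j%:Z) * wsum S (x - j%:Z) y m
    else (x == y)%:R
  else 0.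

Definition green S x y : laurent K := lgen (wsum S x y).

Lemma green_out S x y : ~~ S x -> green S x y = 0.
Proof.
move=> /negPf Sx; apply: laurentP => n; rewrite lcoef0 /=.
by case: ifP => // _; case: absz => [|m] /=; rewrite Sx.
Qed.

Lemma green_rec S x y : S x ->
  lz K * green S x y = (x == y)%:R + transfer (green S ^~ y) x.
Proof.
move=> Sx; apply: laurentP => n; rewrite lcoef_monoM mul1r opprK.
rewrite -[RHS]/((_%:R : laurent K) n + _) lcoef_nat lcoef_transfer.
have [n0|n0] := leP n 0.
  have n1 : n < 1 by lia.
  have z t : green S t y n = 0 by exact: no_low_terms_lgen.
  rewrite z big1 ?addr0 => [|j _]; last by rewrite z mulr0.
  have [->|nN0] := eqVneq n 0; first by rewrite /= Sx andbT.
  by rewrite no_low_terms_lgen ?andbF //; lia.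
have [m ->] : exists m : nat, n = m%:Z + 1 by exists (absz (n - 1)); lia.
rewrite [X in lcoef _ (X + 1)](_ : m%:Z + 1 = m.+1%:Z); last by lia.
rewrite !lcoef_lgen [LHS]/= Sx (_ : (m%:Z + 1 == 0) = false); last by lia.
rewrite andbF add0r; congr (_ + _).
by apply: eq_bigr => j _; rewrite lcoef_lgen.
Qed.

Lemma green_end_out S x y : ~~ S y -> green S x y = 0.
Proof.
move=> Sy; have w0 n t : wsum S t y n = 0.
  elim: n t => [|n IH] t /=; case: ifP => // St.
    by rewrite (_ : (t == y) = false) //; apply: contraNF Sy => /eqP <-.
  by rewrite IH big1 ?addr0 // => j _; rewrite IH mulr0.
by apply: laurentP => n; rewrite lcoef0 /= w0 if_same.
Qed.

Lemma greenT_rec x y :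
  lz K * green predT x y = (x == y)%:R + transfer (green predT ^~ y) x.
Proof. exact: green_rec. Qed.

Definition above i : pred int := fun h => i <= h.
Definition below i : pred int := fun h => h <= i.

(* Decomposition at the last visit to a height [<= i], which is followed by  *)
(* an upstep from i.                                                         *)
Lemma green_last_passage i x y : i < y ->
  green predT x y = green (above (i + 1)) x y
                    + green predT x i * green (above (i + 1)) (i + 1) y.
Proof.
move=> iy; set S := above _.
move: x; apply: (@transfer_unique predT) => // x.
- exact: no_low_terms_lgen.
- by apply: no_low_termsD; [exact: no_low_terms_lgen|exact: no_low_terms_lgenM].
move=> _; rewrite transferD transferM mulrDr !mulrA !greenT_rec.
rewrite addrK; have [Sx|Sx] := boolP (S x).
  rewrite green_rec // mulrDl (_ : (x == i) = false) ?mul0r; first by ring.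
  by move: Sx; rewrite /S /above; lia.
rewrite (green_out _ Sx) (_ : (x == y) = false); last first.
  by move: Sx; rewrite /S /above; lia.
have -> : transfer (green S ^~ y) x = (x == i)%:R * green S (i + 1) y.
  rewrite /transfer big1 ?addr0 => [|j _]; last first.
    by rewrite green_out ?mulr0 //; move: Sx; rewrite /S /above; lia.
  have [->|xi] := eqVneq x i; first by rewrite mul1r.
  by rewrite green_out ?mul0r //; move: Sx; rewrite /S /above; lia.
by rewrite mulr0 mulrDl /= mulr0n; ring.
Qed.

(* A path from below first reaches 0 by an upstep from -1. *)
Lemma green_first_passage_below x : x < 0 ->
  green predT x 0 = green (below (-1)) x (-1) * green predT 0 0.
Proof.
move=> x0; set S := below _.
transitivity
  (green S x (-1) * green predT 0 0 + (0 <= x)%R%:R * green predT x 0);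
  last by rewrite (_ : (0 <= x) = false) ?mul0r ?addr0 //; lia.
move: x {x0}; apply: (@transfer_unique S) => x.
- exact: no_low_terms_lgen.
- apply: no_low_termsD; first exact: no_low_terms_lgenM.
  exact/no_low_terms_natM/no_low_terms_lgen.
- move=> Sx; rewrite (green_out _ Sx) mul0r add0r (_ : 0 <= x) ?mul1r //.
  by move: Sx; rewrite /S /below; lia.
move=> Sx; rewrite transferD transferM mulrDr mulrA greenT_rec addrK.
rewrite green_rec //.
have x0 : x < 0 by move: Sx; rewrite /S /below; lia.
have -> : transfer (fun t => (0 <= t)%R%:R * green predT t 0) x
          = (x == -1)%:R * green predT 0 0.
  rewrite /transfer big1 ?addr0 => [|j _]; last first.
    by rewrite (_ : (0 <= _) = false) ?mul0r ?mulr0 //; lia.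
  have [->|xi] := eqVneq x (-1); first by rewrite mul1r.
  by rewrite (_ : (0 <= _) = false) ?mul0r //; lia.
have -> : (x == 0) = false by lia.
have -> : (0 <= x) = false by lia.
by rewrite /= mulr0n mul0r mulr0 addr0 mulrDl [X in _ - X]addrC subrr.
Qed.

(* Decomposition of a path from above at its first step to a height [<= 0], *)
(* which goes from [j - k > 0] to [- k].                                     *)
Lemma green_first_passage_above x : 0 < x ->
  green predT x 0 =
  \sum_(j < p.+1) \sum_(k < j.+1)
    green (above 1) x (j%:Z - k%:Z)
    * (lconst (a j (- k%:Z)) * green predT (- k%:Z) 0).
Proof.
pose S := above 1; pose c (j : 'I_p.+1) (k : 'I_j.+1) :=
  lconst (a j (- k%:Z)) * green predT (- k%:Z) 0.
pose G (j : 'I_p.+1) t := \sum_(k < j.+1) green S t (j%:Z - k%:Z) * c j k.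
move=> x0; transitivity (\sum_j G j x + (x <= 0)%R%:R * green predT x 0);
  last by rewrite (_ : (x <= 0) = false) ?mul0r ?addr0 //; lia.
move: x {x0}; apply: (@transfer_unique S) => x.
- exact: no_low_terms_lgen.
- apply: no_low_termsD; last exact/no_low_terms_natM/no_low_terms_lgen.
  apply: no_low_terms_sum => j _; apply: no_low_terms_sum => k _.
  by rewrite mulrCA; apply/no_low_terms_constM/no_low_terms_lgenM.
- move=> Sx; rewrite big1 => [|j _]; last first.
    by apply: big1 => k _; rewrite (green_out _ Sx) mul0r.
  by rewrite add0r (_ : x <= 0) ?mul1r //; move: Sx; rewrite /S /above; lia.
move=> Sx; have x0 : 0 < x by move: Sx; rewrite /S /above; lia.
have -> : (x <= 0) = false by lia.
rewrite mul0r addr0 greenT_rec addrK transferD transfer_sum mulr_sumr.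
rewrite opprD addrA.
have -> : (x == 0) = false by lia.
rewrite -sumrB /transfer.
have -> : (x + 1 <= 0) = false by lia.
rewrite mul0r add0r -sumrB big1 // => j _.
apply/eqP; rewrite subr_eq0; apply/eqP.
rewrite -[X in _ - X]/(transfer (G j) x) transfer_sum mulr_sumr -sumrB.
transitivity (\sum_(k < j.+1) (x == j%:Z - k%:Z)%:R * c j k).
  by apply: eq_bigr => k _; rewrite transferM mulrA green_rec // -mulrBl addrK.
have [xj|jx] := leP x j%:Z.
  have kj : (absz (j%:Z - x) < j.+1)%N by lia.
  rewrite (bigD1 (Ordinal kj)) //= big1 => [|k /eqP kN]; last first.
    rewrite (_ : (x == _) = false) ?mul0r //; apply/eqP => E; apply: kN.
    by apply: val_inj => /=; lia.
  have -> : x == j%:Z - (absz (j%:Z - x))%:Z by lia.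
  have -> : x - j%:Z <= 0 by lia.
  rewrite addr0 !mul1r /c /=.
  by have -> : - (absz (j%:Z - x))%:Z = x - j%:Z by lia.
have -> : (x - j%:Z <= 0) = false by lia.
rewrite mul0r mulr0 big1 // => k _.
by rewrite (_ : (x == _) = false) ?mul0r //; have := ltn_ord k; lia.
Qed.

End Resolvent.

Section PathSums.
Variables (p : nat) (K : fieldType) (a : 'I_p.+1 -> int -> K).
Implicit Types (S : pred int) (x y : int) (g : lpath p).

Definition path_in S g := all (fun v => S v.2) (vertices g).

Lemma target_shift g q :
  target (path_shift g q) = ((target g).1, (target g).2 + q).
Proof.
case: g => v s; rewrite /target /=.
by elim: s v => //= t s IH v; rewrite -IH /next_vertex /= addrAC.
Qed.

Lemma path_in_shift S g q :
  path_in S (path_shift g q) = path_in (fun h => S (h + q)) g.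
Proof.
case: g => v s; rewrite /path_in /=; congr (_ && _).
elim: s v => //= t s IH v; rewrite -IH /next_vertex /=.
by rewrite (addrAC v.2).
Qed.

Lemma minh_eq g c :
  c \in [seq v.2 | v <- vertices g] -> (minh g == c) = path_in (above c) g.
Proof.
move=> /mapP[w wg cE]; apply/eqP/allP => [<- v vg|cg].
  exact: ge_bigmin_seq.
apply/le_anti/andP; split; first by rewrite cE; exact: ge_bigmin_seq.
rewrite /minh big_seq; apply: le_bigmin => [|v vg]; last exact: cg.
by apply: cg; rewrite mem_head.
Qed.

Lemma maxh_eq g c :
  c \in [seq v.2 | v <- vertices g] -> (maxh g == c) = path_in (below c) g.
Proof.
move=> /mapP[w wg cE]; apply/eqP/allP => [<- v vg|cg].
  exact: le_bigmax_seq.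
apply/le_anti/andP; split; last by rewrite cE; exact: le_bigmax_seq.
rewrite /maxh big_seq; apply: bigmax_le => [|v vg]; last exact: cg.
by apply: cg; rewrite mem_head.
Qed.

Lemma sum_step (F : step p -> K) :
  \sum_s F s = F None + \sum_(j < p.+1) F (Some j).
Proof.
rewrite (bigD1 None) //=; congr (_ + _).
rewrite (reindex_omap Some id) => [|[]//].
by apply: eq_bigl => j /=; rewrite eqxx.
Qed.

Lemma sum_tuple_cons (T : finType) n (F : seq T -> K) :
  \sum_(s : n.+1.-tuple T) F s = \sum_t \sum_(s : n.-tuple T) F (t :: s).
Proof.
rewrite pair_big /=.
rewrite (reindex (fun ts : T * n.-tuple T => [tuple of ts.1 :: ts.2])) //=.
exists (fun s : n.+1.-tuple T => (thead s, [tuple of behead s])).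
  move=> [t s] _.
  by congr (_, _); apply: val_inj.
by move=> s _; rewrite -tuple_eta.
Qed.

Lemma sum_paths S m x y n :
  \sum_(s : n.-tuple (step p) |
        (target (LPath (m, x) s) == ((m + n)%N, y))
        && path_in S (LPath (m, x) s))
     weight a (LPath (m, x) s) = wsum a S x y n.
Proof.
pose w n m x (s : seq (step p)) :=
  if (target (LPath (m, x) s) == ((m + n)%N, y)) && path_in S (LPath (m, x) s)
  then weight a (LPath (m, x) s) else 0.
rewrite big_mkcond -[LHS]/(\sum_(s : n.-tuple (step p)) w n m x s).
elim: n m x => [|n IH] m x.
  rewrite (big_pred1 [tuple]) => [|s]; last exact/esym/eqP/tuple0.
  rewrite /w /weight /path_in /target /= big_nil andbT addn0 xpair_eqE eqxx /=.
  by case: (S x); rewrite ?andbT ?andbF //; case: eqP.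
have w_cons t s : w n.+1 m x (t :: s) =
    (S x)%:R * (step_weight a (m, x) t * w n m.+1 (x + rise t) s).
  rewrite /w /weight /path_in /target /= big_cons addnS addSn /next_vertex /=.
  by case: (S x); rewrite /= ?andbF ?mul0r // mul1r; case: ifP; rewrite ?mulr0.
rewrite (sum_tuple_cons _ (w n.+1 m x)).
under eq_bigr => t _.
  under eq_bigr do rewrite w_cons.
  rewrite -!mulr_sumr IH; over.
rewrite -mulr_sumr /=; case: (S x); rewrite ?mul0r // mul1r sum_step /=.
by rewrite mul1r.
Qed.

Lemma Wcoef_wsum y n : Wcoef a y n = wsum a predT 0 y n.
Proof.
rewrite -(sum_paths predT 0); apply: eq_bigl => s.
by rewrite /path_in all_predT andbT.
Qed.

Lemma Acoef_wsum q j n : Acoef a q j n = wsum a (above q) q (j + q) n.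
Proof.
rewrite -(sum_paths _ 0) add0n.
apply: eq_big => s; last by rewrite /path_shift /= add0r.
have -> : LPath (0%N, q) s = path_shift (LPath (0%N, 0) s) q.
  by rewrite /path_shift /= add0r.
rewrite target_shift path_in_shift minh_eq ?mem_head //.
case: target => u h; rewrite !xpair_eqE (inj_eq (addIr q)); congr (_ && _).
by apply: eq_all => v; rewrite /above; lia.
Qed.

Lemma Bcoef_wsum q j n :
  Bcoef a q j n = wsum a (below (- q)) (- j - q) (- q) n.
Proof.
rewrite -(sum_paths _ 0) add0n; apply: eq_bigl => s.
rewrite -[LPath (0%N, - j - q) s]/(path_shift (LPath (0%N, - j) s) (- q)).
rewrite target_shift path_in_shift.
have [E|NE] := eqVneq (target _) (n, 0); last first.
  apply/esym/negbTE; rewrite negb_and; apply/orP; left; apply: contraNneq NE.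
  by case: target => u h [-> E]; apply/eqP; congr (_, _); lia.
rewrite E [(_, _).2]/= add0r eqxx maxh_eq; last first.
  apply/mapP; exists (n, 0) => //; rewrite -E /target /=; exact: mem_last.
by apply: eq_all => v; rewrite /below; lia.
Qed.

Lemma Wser_green y : Wser a y = green a predT 0 y.
Proof. by congr lgen; apply/funext => n; exact: Wcoef_wsum. Qed.

Lemma Aser_green q j : j != -1 -> Aser a q j = green a (above q) q (j + q).
Proof.
move=> /negPf jN; rewrite /Aser jN; congr lgen.
by apply/funext => n; exact: Acoef_wsum.
Qed.

Lemma Bser_green q j : j != -1 ->
  Bser a q j = green a (below (- q)) (- j - q) (- q).
Proof.
move=> /negPf jN; rewrite /Bser jN; congr lgen.
by apply/funext => n; exact: Bcoef_wsum.
Qed.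

Lemma Wser_last_passage i y : i < y -> 0 <= i ->
  Wser a y = Wser a i * Aser a (i + 1) (y - i - 1).
Proof.
move=> iy i0; rewrite Aser_green; last by lia.
rewrite !Wser_green (green_last_passage _ _ iy).
rewrite (@green_out _ _ _ _ 0); last by rewrite /above; lia.
by rewrite add0r; congr (_ * green _ _ _ _); lia.
Qed.

Lemma Bser_first_passage (k : nat) :
  Bser a 1 (k%:Z - 1) * Wser a 0 = green a predT (- k%:Z) 0.
Proof.
rewrite Wser_green; case: k => [|k]; first by rewrite /Bser mul1r oppr0.
rewrite (@green_first_passage_below _ _ _ (- _)) ?Bser_green; [|lia..].
by congr (green _ _ _ _ * _); lia.
Qed.

Lemma Wser0_equation :
  Wser a 0 * (lz K - lconst (a ord0 0)
    - \sum_(j < p.+1 | (1 <= j)%N) \sum_(k < j.+1)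
        lconst (a j (- k%:Z)) * Aser a 1 (j%:Z - k%:Z - 1)
        * Bser a 1 (k%:Z - 1)) = 1.
Proof.
pose c (j : 'I_p.+1) (k : nat) :=
  lconst (a j (- k%:Z)) * green a predT (- k%:Z) 0.
pose G (j : 'I_p.+1) : laurent K :=
  \sum_(k < j.+1) green a (above 1) 1 (j%:Z - k%:Z) * c j k.
have gA0 : green a (above 1) 1 0 = 0 by exact: green_end_out.
have rowE (j : 'I_p.+1) : (\sum_(k < j.+1)
    lconst (a j (- k%:Z)) * Aser a 1 (j%:Z - k%:Z - 1) * Bser a 1 (k%:Z - 1))
    * Wser a 0 = G j + c j j.
  rewrite mulr_suml /G !big_ord_recr /= subrr gA0 mul0r addr0; congr (_ + _).
    apply: eq_bigr => k _; have := ltn_ord k => kj.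
    rewrite -mulrA Bser_first_passage Aser_green ?subrK; last by lia.
    by rewrite /c mulrA [X in X * _]mulrC.
  by rewrite -mulrA Bser_first_passage /Aser eqxx mulr1.
have z0 : lz K * Wser a 0 = 1 + \sum_(j < p.+1) (G j + c j j).
  rewrite Wser_green greenT_rec eqxx /transfer add0r.
  rewrite green_first_passage_above // big_split /=; congr (_ + (_ + _)).
  by apply: eq_bigr => j _; rewrite /c sub0r.
rewrite mulrC !mulrBl z0 mulr_suml (eq_bigr _ (fun j _ => rowE j)).
rewrite (bigD1 ord0) //=.
rewrite [X in _ - X](eq_bigl (fun j : 'I_p.+1 => j != ord0)) => [|j];
  last by rewrite lt0n.
have -> : G ord0 + c ord0 0%N = lconst (a ord0 0) * Wser a 0.
  rewrite /G big_ord1 /= subrr gA0 mul0r add0r /c oppr0.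
  by rewrite Wser_green.
by rewrite addrA addrAC addrK addrK.
Qed.

End PathSums.

Theorem theorem1p4 (R : realType) (p : nat) (hp : (1 <= p)%N)
    (a : 'I_p.+1 -> int -> R[i]%C) :
  [/\ Wser a 0 =
        1 / (lz _ - lconst (a ord0 0)
             - \sum_(j < p.+1 | (1 <= j)%N) \sum_(k < j.+1)
                 lconst (a j (- k%:Z))
                 * Aser a 1 (j%:Z - k%:Z - 1) * Bser a 1 (k%:Z - 1)),
      forall j : nat, (1 <= j <= p)%N ->
        Wser a j%:Z = Wser a 0 * Aser a 1 (j%:Z - 1)
    & forall i j : nat, (i < j)%N -> (j <= p)%N ->
        Wser a j%:Z = Wser a i%:Z * Aser a (i%:Z + 1) (j%:Z - i%:Z - 1)].
Proof.
have E := Wser0_equation a; split => [|j /andP[j1 _]|i j ij _].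
- set D := (X in 1 / X); have D0 : D != 0.
    by apply: contra_eq_neq E => D0; rewrite -/D D0 mulr0 eq_sym oner_neq0.
  by rewrite -[in RHS]E mulfK.
- by rewrite (@Wser_last_passage _ _ _ 0) // add0r subr0.
- exact: Wser_last_passage.
Qed.
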